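(* Let $T$ and $S$ be number-theoretic transformations on the same space $\Omega$. If there exist positive integers $n$ and $m$ such that $T^n = S^m$, then $T$ and $S$ are normal-equivalent, i.e. a point $x\in\Omega$ is $T$-normal if and only if it is $S$-normal.
   Context: Number-theoretic transformations. Let $\Omega\subset\mathbb{R}^m$ be a bounded space with a $\sigma$-algebra $\Sigma$. A map $T:\Omega\to\Omega$ is a number-theoretic transformation if: (1) $T^{-1}\Sigma\subseteq\Sigma$. (2) There is a set $\mathcal{D}\subset\mathbb{N}$ (the set of digits) and a partition of $\Omega$ into disjoint sets $\{I_d\}_{d\in\mathcal{D}}$ with $\bigcup_{d\in\mathcal{D}} I_d=\Omega$. (3) The restriction $T_d:=T|_{I_d}$ is continuous and injective for each $d\in\mathcal{D}$. (4) For any finite string of digits $s=[d_1,\dots,d_l]$, the cylinder set $C_s=C[d_1,\dots,d_l]=T_{d_1}^{-1}T_{d_2}^{-1}\cdots T_{d_l}^{-1}\Omega$ belongs to $\Sigma$. A string $s$ is admissible if $C_s$ is non-empty. For every $x\in\Omega$ there is a unique infinite string of digits $[\mathfrak{d}_1,\mathfrak{d}_2,\dots]$ such that $x$ is the only point contained in all the nested cylinder sets $C[\mathfrak{d}_1]\supset C[\mathfrak{d}_1,\mathfrak{d}_2]\supset\cdots$ (the $T$-expansion of $x$). (5) There is a unique probability measure $\mu:\Sigma\to[0,1]$, equivalent to Lebesgue measure, that is $T$-invariant: $\mu(T^{-1}A)=\mu(A)$ for all $A\in\Sigma$. (6) $T$ is ergodic: for any $A\in\Sigma$, if $T^{-1}A$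 equals $A$ up to a set of $\mu$-measure zero, then $\mu(A)\in\{0,1\}$. For a positive integer $k$, the iterate $T^k$ is regarded as a number-theoretic transformation whose digits correspond to length-$k$ strings of $T$-digits, so that a string of $n$ digits of $T^k$ corresponds to a string of $nk$ digits of $T$ with the same cylinder set. Normality. A point $x\in\Omega$ is $T$-normal if for all admissible strings $s$ (for $T$), $$\lim_{N\to\infty}\frac{\#\{0\le n<N \mid T^n x\in C_s\}}{N}=\mu(C_s).$$ For $S$-normality the cylinder sets, admissible strings and measure are those of $S$. *)

(* Defs.v *)
From HB Require Import structures.
From mathcomp Require Import all_boot all_order all_algebra.
From mathcomp Require Import all_classical all_reals all_analysis.

Set Implicit Arguments.
Unset Strict Implicit.
Unset Printing Implicit Defensive.

Import Order.TTheory GRing.Theory Num.Theory numFieldNormedType.Exports.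
Local Open Scope classical_set_scope.
Local Open Scope ring_scope.

Section Lebesgue.
Variables (R : realType) (m : nat).

Definition box (a b : 'rV[R]_m) : set 'rV[R]_m :=
  [set x | forall i, a ord0 i <= x ord0 i <= b ord0 i].

Definition box_volume (a b : 'rV[R]_m) : R :=
  \prod_(i < m) Num.max 0 (b ord0 i - a ord0 i).

(* The library has Lebesgue measure on R only.  The index set D makes finite
   and empty families of boxes available, also in dimension 0. *)
Definition lebesgue_outer (A : set 'rV[R]_m) : \bar R :=
  ereal_inf [set v | exists (D : set nat) (a b : nat -> 'rV[R]_m),
    A `<=` \bigcup_(k in D) box (a k) (b k) /\
    v = (\esum_(k in D) (box_volume (a k) (b k))%:E)%E].

End Lebesgue.

(* A measurableType has a base point; this alias provides one. *)
Definition pointed_at (X : choiceType) (w : X) : Type := X.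

HB.instance Definition _ (X : choiceType) (w : X) :=
  Choice.copy (pointed_at w) X.
HB.instance Definition _ (X : choiceType) (w : X) :=
  isPointed.Build (pointed_at w) w.

(* The underlying type with the sigma-algebra generated by Sigma, which is
   Sigma itself as soon as Sigma is a sigma-algebra (measurable_g_measurableTypeE). *)
Notation sigma_space w Sigma :=
  (g_sigma_algebraType (Sigma : set (set (pointed_at w)))).

(* Only the values of [cell] at elements of [digit] are relevant. *)
Record digit_map (X : Type) := DigitMap {
  dmap :> X -> X;
  digit : set nat;
  cell : nat -> set X
}.

Section DigitMaps.
Variable X : Type.
Implicit Types T S : digit_map X.

Definition digit_string T (s : seq nat) : Prop :=
  forall d, d \in s -> digit T d.

Fixpoint cylinder T (s : seq nat) : set X :=
  if s is d :: s' then cell T d `&` T @^-1` cylinder T s' else setT.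

Definition admissible T (s : seq nat) : Prop :=
  digit_string T s /\ cylinder T s !=set0.

(* The digits of T^k are the T-strings of length k, encoded as natural numbers
   by the bijection CodeSeq.code : seq nat -> nat. *)
Definition iterate T (k : nat) : digit_map X := {|
  dmap := iter k T;
  digit := [set CodeSeq.code s | s in [set s | size s = k /\ digit_string T s]];
  cell := fun c => cylinder T (CodeSeq.decode c)
|}.

(* Equality of maps together with their digit partitions, up to the names of
   the digits and to digits with an empty cell.  The partitions matter: for the
   doubling map with its binary digits, splitting each cell along the orbit of
   a normal point gives the same map, for which that point is not normal. *)
Definition same_digit_map T S : Prop :=
  T =1 S /\
  [set cell T d | d in digit T] `\ set0 = [set cell S d | d in digit S] `\ set0.

Lemma cylinder_cat T s t :
  cylinder T (s ++ t) = cylinder T s `&` iter (size s) T @^-1` cylinder T t.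
Proof.
elim: s => [|d s IH] /=; first by rewrite setTI.
rewrite IH; apply/seteqP; split => x /=; rewrite -iterS iterSr.
  by case=> ? [].
by case=> [[]].
Qed.

Lemma cylinder_iterate T k (ss : seq (seq nat)) :
  (forall s, s \in ss -> size s = k) ->
  cylinder (iterate T k) (map CodeSeq.code ss) = cylinder T (flatten ss).
Proof.
elim: ss => [//|s ss IH] Hss /=.
rewrite CodeSeq.codeK cylinder_cat (Hss s) ?mem_head// IH// => t tss.
by apply: Hss; rewrite inE tss orbT.
Qed.

End DigitMaps.

Section NumberTheoretic.
Variables (R : realType) (m : nat) (Omega : set 'rV[R]_m) (w : Omega).
Variable Sigma : set (set Omega).
Implicit Types (T : digit_map Omega) (mu : probability (sigma_space w Sigma) R).

(* The first conjunct says that Lebesgue measure is defined on Sigma. *)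
Definition equivalent_to_lebesgue mu : Prop :=
  forall A : set Omega, Sigma A ->
    (@lebesgue_outer R m).-caratheodory (set_val @` A) /\
    (mu A = 0%E <-> lebesgue_outer (set_val @` A) = 0%E).

Definition invariant_measure T mu : Prop :=
  forall A : set Omega, Sigma A -> mu (T @^-1` A) = mu A.

Definition ergodic T mu : Prop :=
  forall A : set Omega, Sigma A ->
    mu ((T @^-1` A) `+` A) = 0%E -> mu A = 0%E \/ mu A = 1%E.

Record number_theoretic T mu : Prop := {
  nt_measurable : forall A : set Omega, Sigma A -> Sigma (T @^-1` A);
  nt_disjoint : trivIset (digit T) (cell T);
  nt_cover : cover (digit T) (cell T) = setT;
  nt_continuous : forall d, digit T d -> {within cell T d, continuous T};
  nt_injective : forall d, digit T d -> {in cell T d &, injective T};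
  nt_cylinder : forall s, digit_string T s -> Sigma (cylinder T s);
  nt_expansion : forall x : Omega, exists! e : nat -> nat,
    (forall i, digit T (e i)) /\
    \bigcap_l cylinder T (mkseq e l) = [set x];
  nt_equivalent : equivalent_to_lebesgue mu;
  nt_invariant : invariant_measure T mu;
  nt_unique : forall nu : probability (sigma_space w Sigma) R,
    equivalent_to_lebesgue nu -> invariant_measure T nu ->
    forall A : set Omega, Sigma A -> nu A = mu A;
  nt_ergodic : ergodic T mu
}.

Definition normal T mu (x : Omega) : Prop :=
  forall s, admissible T s ->
    (fun N : nat => #|[pred i : 'I_N | iter i T x \in cylinder T s]|%:R / N%:R : R)
      @ \oo --> fine (mu (cylinder T s)).

End NumberTheoretic.

(* Main.v *)
Require Import Defs.
From HB Require Import structures.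
From mathcomp Require Import all_boot all_order all_algebra.
From mathcomp Require Import all_classical all_reals all_analysis.
From mathcomp Require Import measurable_realfun ring lra zify.

Set Implicit Arguments.
Unset Strict Implicit.
Unset Printing Implicit Defensive.

Import Order.TTheory GRing.Theory Num.Theory numFieldNormedType.Exports.
Local Open Scope classical_set_scope.
Local Open Scope ring_scope.

(** The link between the two measures is that both are equivalent to Lebesgue
    measure, so that they have the same null sets.  Ergodicity enters through
    [T] and [S] themselves, since the common iterate [T^n = S^k] can fail to be
    ergodic.

    Let [x] be [T]-normal and let [A] be a union of cylinders of [S] of a fixed
    length.  It suffices that the [S]-orbit of [x] visits [A] with upper
    frequency at most [muS A]: applied to [A] and to its complement, this gives
    the limit.  Fix [c > muS A] and let [E_M] be the set [excess S A c M] of the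
    points whose average number of visits to [A] exceeds [c] at every time
    [1, ..., M].  A point outside [E_M] has a time at most [M] at which its
    average is at most [c]; cutting an orbit into such blocks shows that visits
    to [A] occur at rate at most [c], up to the visits to [E_M] itself
    ([visits_block]).  By ergodicity of [S] the sets [E_M] decrease to a
    [muS]-null set ([ergodic_excess0]), which is therefore also [muT]-null, and
    so are its preimages under the powers of [S].

    It remains to see that [x] visits [E_M] rarely under [S].  Split the times
    into residues [r] modulo [k] ([visits_iterate]): the visits at times
    congruent to [r] are visits of the [S^k]-orbit to the preimage of [E_M] by
    [S^r].  As [S^k = T^n], they are among the visits of the [T]-orbit to this
    preimage.  Whether a point lies in the preimage depends on finitely many
    [S]-digits ([saturated_excess]), hence on finitely many [T]-digits, because
    [T^n] and [S^k] have the same cells ([saturated_same_iterate]).  For such a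
    set the [T]-normality of [x] gives the frequency under [T], namely its
    [muT]-measure ([generic_freq_le]), which is small for [M] large. *)

(** * Counting visits *)

Section Visits.
Variables (X : Type) (f : X -> X).
Implicit Types (A B : set X) (N M r : nat) (x y : X).

Definition visits A N x : nat := \sum_(i < N) (iter i f x \in A).

Lemma visitsD A N M x :
  visits A (N + M) x = (visits A N x + visits A M (iter N f x))%N.
Proof.
rewrite /visits big_split_ord/=; congr addn.
by apply: eq_bigr => i _; rewrite -iterD addnC.
Qed.

Lemma visitsS A N x : visits A N.+1 x = ((x \in A) + visits A N (f x))%N.
Proof. by rewrite -add1n visitsD /visits big_ord_recl big_ord0 addn0. Qed.

Lemma leq_visits A N M x : (N <= M)%N -> (visits A N x <= visits A M x)%N.
Proof. by move=> /subnKC <-; rewrite visitsD leq_addr. Qed.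

Lemma sub_visits A B N x : A `<=` B -> (visits A N x <= visits B N x)%N.
Proof.
move=> AB; apply: leq_sum => i _.
case: (boolP (_ \in A)) => // /set_mem/AB/mem_set ->.
exact: leqnn.
Qed.

Lemma visits_setC A N x : (visits A N x + visits (~` A) N x)%N = N.
Proof.
rewrite /visits -big_split/=.
rewrite (eq_bigr (fun=> 1%N)) ?sum1_card ?card_ord// => i _.
by rewrite in_setC; case: (_ \in A).
Qed.

Lemma visits_setU A B N x : [disjoint A & B] ->
  visits (A `|` B) N x = (visits A N x + visits B N x)%N.
Proof.
move=> /disj_setPS AB; rewrite /visits -big_split/=; apply: eq_bigr => i _.
rewrite in_setU.
case: (boolP (_ \in A)); case: (boolP (_ \in B)) => // /set_mem ? /set_mem ?.
by have [] := AB (iter i f x).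
Qed.

End Visits.

(** Splitting the times below [k * N] by their residues modulo [k]. *)
Lemma visits_iterate X (f : X -> X) (A : set X) k N x :
  visits f A (k * N) x =
  (\sum_(r < k) visits (iter k f) (iter r f @^-1` A) N x)%N.
Proof.
elim: N x => [|N IH] x.
  by rewrite muln0 /visits big_ord0 big1// => i _; rewrite big_ord0.
rewrite mulnS visitsD IH.
under [RHS]eq_bigr do rewrite visitsS.
by rewrite big_split.
Qed.

Lemma visits_iter_leq X (f : X -> X) (A : set X) n N x : (0 < n)%N ->
  (visits (iter n f) A N x <= visits f A (n * N) x)%N.
Proof.
move=> n0; rewrite visits_iterate (bigD1 (Ordinal n0))//=.
by rewrite leq_addr.
Qed.

Section BlockBound.
Variables (R : realDomainType) (X : Type) (f : X -> X) (A : set X) (c : R).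

(** The exceptional points when orbits are cut into blocks of length at most [M]
    in which visits have frequency at most [c]. *)
Definition excess M : set X :=
  [set y | forall j, (0 < j <= M)%N -> c * j%:R < (visits f A j y)%:R].

Lemma excess_nonincreasing : nonincreasing_seq excess.
Proof.
move=> M M' MM'; apply/subsetPset => y yM j /andP[j0 jM]; apply: yM.
by rewrite j0 (leq_trans jM).
Qed.

(** Induction on [N], cutting the orbit into blocks.  At a point of [excess M]
    take a block of length one, whose possible visit to [A] is paid for by the
    visit to [excess M]; at any other point take a block of length at most [M]
    on which at most the proportion [c] of the times are visits.  The last
    block may run past [N], which costs the additional [c * M]. *)
Lemma visits_block M N y : 0 <= c ->
  (visits f A N y)%:R <= c * (N + M)%:R + (visits f (excess M) N y)%:R.
Proof.
move=> c0; elim/ltn_ind: N y => -[|N] IH y.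
  by rewrite /visits !big_ord0 addr0 mulr_ge0.
have [yM|/existsNP[j /not_implyP[/andP[j0 jM] /negP]]] := pselect (excess M y).
  have := IH N (ltnSn N) (f y).
  have yA : (y \in A)%:R <= 1 :> R by case: (y \in A).
  rewrite !visitsS (mem_set yM) -[N.+1]addn1 !natrD !mulrDr mulr1.
  by rewrite [true%:R]mulr1n; move: c0 yA; lra.
rewrite -leNgt => hj; have [Nj|jN] := leqP N.+1 j.
  have vj : (visits f A N.+1 y)%:R <= (visits f A j y)%:R :> R.
    by rewrite ler_nat leq_visits.
  have jR : c * j%:R <= c * (N.+1 + M)%:R.
    by rewrite ler_wpM2l// ler_nat (leq_trans jM)// leq_addl.
  have v0 : 0 <= (visits f (excess M) N.+1 y)%:R :> R by [].
  lra.
have [i Ni i0] : exists2 i, N.+1 = (j + i)%N & (i < N.+1)%N.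
  by exists (N.+1 - j)%N; lia.
have := IH i i0 (iter j f y); rewrite {i0} Ni !visitsD -addnA !natrD !mulrDr.
have : 0 <= (visits f (excess M) j y)%:R :> R by [].
lra.
Qed.

End BlockBound.

(** * Excessive visits in an ergodic system *)

Section Ergodic.
Local Open Scope ereal_scope.
Context {d : measure_display} {X : measurableType d} {R : realType}.
Variables (mu : probability X R) (f : X -> X).
Hypothesis mf : forall A, measurable A -> measurable (f @^-1` A).
Hypothesis inv_f : forall A, measurable A -> mu (f @^-1` A) = mu A.

Lemma measurable_iter i A : measurable A -> measurable (iter i f @^-1` A).
Proof.
by elim: i A => [//|i IH] A mA; exact: (IH (f @^-1` A) (mf mA)).
Qed.

Lemma measure_iter i A : measurable A -> mu (iter i f @^-1` A) = mu A.
Proof.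
elim: i A => [//|i IH] A mA; rewrite -(inv_f mA); exact: (IH _ (mf mA)).
Qed.

(** The number of visits by time [j] is expressed through the number by time
    [j - 1] from the image point, so induction on [j] applies. *)
Lemma measurable_visits A (P : set nat) j : measurable A ->
  measurable [set y | P (visits f A j y)].
Proof.
move=> mA; elim: j P => [|j IH] P.
  have [P0|P0] := pselect (P 0%N).
    rewrite (_ : mkset _ = setT)//; apply/seteqP; split => // y _ /=.
    by rewrite /visits big_ord0.
  rewrite (_ : mkset _ = set0)//; apply/seteqP; split => // y /=.
  by rewrite /visits big_ord0.
have -> : [set y | P (visits f A j.+1 y)] =
    A `&` f @^-1` [set y | P (visits f A j y).+1] `|`
    ~` A `&` f @^-1` [set y | P (visits f A j y)].
  apply/seteqP; split=> y /=; rewrite visitsS.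
    have [yA|yA] := pselect (A y); first by rewrite mem_set//; left.
    by rewrite memNset//; right.
  by case=> -[yA]; [rewrite mem_set|rewrite memNset].
apply: measurableU; apply: measurableI => //; try exact: measurableC.
  by apply: mf; exact: (IH [set v | P v.+1]).
by apply: mf; exact: IH.
Qed.

Lemma measurable_excess A (c : R) M :
  measurable A -> measurable (excess f A c M : set X).
Proof.
move=> mA; rewrite (_ : excess _ _ _ _ =
    \bigcap_(j in [set j | (0 < j <= M)%N])
      [set y | (c * j%:R < (visits f A j y)%:R)%R]).
  apply: bigcap_measurableType => j _.
  exact: (@measurable_visits A [set v | (c * j%:R < v%:R)%R]).
by apply/seteqP; split=> y /= h j; exact: h.
Qed.

Lemma integral_visits A N : measurable A ->
  \int[mu]_x (visits f A N x)%:R%:E = N%:R%:E * mu A.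
Proof.
move=> mA.
transitivity (\int[mu]_x \sum_(i < N) (\1_(iter i f @^-1` A) x)%:E).
  apply: eq_integral => x _; by rewrite sumEFin /visits natr_sum.
rewrite ge0_integral_sum//=; last first.
  by move=> i; apply/measurable_EFinP/measurable_indic; exact: measurable_iter.
rewrite (eq_bigr (fun=> mu A)) => [|i _].
  by rewrite sumr_const card_ord mule_natl.
rewrite integral_indic//; last exact: measurable_iter.
by rewrite setIT; exact: measure_iter.
Qed.

(** Markov's inequality for the number of visits, whose mean is [N * mu A]. *)
Lemma visits_ge_measure A (a : R) N (H : set X) :
  measurable A -> measurable H -> (0 <= a)%R ->
  (forall y, H y -> a <= (visits f A N y)%:R)%R ->
  a%:E * mu H <= N%:R%:E * mu A.
Proof.
move=> mA mH a0 Ha; rewrite -integral_visits//.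
have mv : measurable_fun setT (fun x => ((visits f A N x)%:R : R)%:E).
  apply/measurable_EFinP => mD B mB; rewrite setTI {mD}.
  exact: (@measurable_visits A [set v | B v%:R]).
rewrite -(integral_cst mu mH).
rewrite (@le_trans _ _ (\int[mu]_(x in H) (visits f A N x)%:R%:E))//.
  by apply: ge0_le_integral => //; exact: measurable_funTS.
exact: ge0_subset_integral.
Qed.

Hypothesis erg_f : forall A, measurable A ->
  mu ((f @^-1` A) `+` A) = 0 -> mu A = 0 \/ mu A = 1.

(** The points that never fall more than a constant [K] behind [c * j] visits
    form an invariant set, which contains the intersection considered here (take
    [K = 0]).  If that set had full measure, Markov's inequality at large times
    would give [mu A >= c]. *)
Lemma ergodic_excess0 A (c : R) : measurable A -> mu A < c%:E ->
  mu (\bigcap_M excess f A c M) = 0.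
Proof.
move=> mA Ac.
pose H K := [set y | forall j, (c * j%:R - K%:R <= (visits f A j y)%:R)%R].
have mH K : measurable (H K).
  rewrite (_ : H K = \bigcap_j
      [set y | (c * j%:R - K%:R <= (visits f A j y)%:R)%R]).
    apply: bigcapT_measurable => j.
    exact: (@measurable_visits A [set v | (c * j%:R - K%:R <= v%:R)%R]).
  by apply/seteqP; split=> y /= h j; [move=> _|]; exact: h.
have Hmono : nondecreasing_seq H.
  move=> K K' KK'; apply/subsetPset => y yH j; apply: le_trans (yH j).
  by rewrite lerD2l lerN2 ler_nat.
have mHH : measurable (\bigcup_K H K) by exact: bigcupT_measurable.
have c0 : (0 <= c)%R by rewrite -lee_fin (le_trans _ (ltW Ac)).
have Hinv : f @^-1` (\bigcup_K H K) = \bigcup_K H K.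
  (* Moving the starting point by one step changes [K] by at most [max 1 c]. *)
  have [K cK] : exists K : nat, (c <= K%:R)%R.
    by exists (Num.truncn c).+1; exact/ltW/truncnS_gt.
  apply/seteqP; split=> y [K' _ yH].
    exists (K + K')%N => // -[|j].
      by rewrite mulr0 sub0r (@le_trans _ _ 0%R)// oppr_le0.
    rewrite visitsS; have := yH j; rewrite -[j.+1]addn1 !natrD.
    have : (0 <= (y \in A)%:R :> R)%R by [].
    by move: cK; lra.
  exists K'.+1 => // j; have := yH j.+1; rewrite visitsS natrD -[j.+1]addn1.
  rewrite -[K'.+1]addn1 !natrD.
  have : ((y \in A)%:R <= 1 :> R)%R by case: (y \in A).
  by move: c0; lra.
have [H0|H1] : mu (\bigcup_K H K) = 0 \/ mu (\bigcup_K H K) = 1.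
- by apply: erg_f => //; rewrite Hinv setYK measure0.
- apply: (subset_measure0 _ mHH _ H0).
    by apply: bigcapT_measurable => M; exact: measurable_excess.
  move=> y yE; exists 0%N => // -[|j]; first by rewrite mulr0 subr0.
  by rewrite subr0 ltW// (yE j.+1 I j.+1)// ltnSn.
exfalso; suff : c%:E <= mu A by rewrite leNgt Ac.
have HK K : c%:E * mu (H K) <= mu A.
  pose p := fine (mu (H K)); pose a := fine (mu A).
  have pE : mu (H K) = p%:E by rewrite fineK ?fin_num_measure.
  have aE : mu A = a%:E by rewrite fineK ?fin_num_measure.
  have p0 : (0 <= p)%R by rewrite fine_ge0.
  have a0 : (0 <= a)%R by rewrite fine_ge0.
  have bound N : ((c * N%:R - K%:R) * p <= N%:R * a)%R.
    have [cN|cN] := leP 0%R (c * N%:R - K%:R)%R.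
      by rewrite -lee_fin !EFinM -pE -aE visits_ge_measure.
    apply: (@le_trans _ _ 0%R); last exact: mulr_ge0.
    by rewrite mulr_le0_ge0// ltW.
  rewrite pE aE -EFinM lee_fin leNgt; apply/negP => acp.
  have q0 : (0 < c * p - a)%R by rewrite subr_gt0.
  (* [bound] says [N * (c * p - a) <= K * p], which fails for large [N]. *)
  have := bound (Num.truncn (K%:R * p / (c * p - a))).+1.
  have := truncnS_gt (K%:R * p / (c * p - a)); rewrite ltr_pdivrMr//.
  set N := (_.+1%:R : R).
  by lra.
have cvgH : c%:E * mu (H K) @[K --> \oo] --> c%:E * 1.
  rewrite -H1; apply: cvgeZl => //.
  exact: nondecreasing_cvg_mu.
rewrite mule1 in cvgH.
by apply: (cvge_le _ cvgH); exact: nearW.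
Qed.

End Ergodic.

(** * Bounds on frequencies *)

Section Frequency.
Variables (R : realType) (X : Type) (f : X -> X) (x : X).
Implicit Types (A B : set X) (a b : R).

Definition freq_ge A a := forall e, 0 < e ->
  \forall N \near \oo, (a - e) * N%:R <= (visits f A N x)%:R.

Definition freq_le A a := forall e, 0 < e ->
  \forall N \near \oo, (visits f A N x)%:R <= (a + e) * N%:R.

Lemma cvg_freq A a :
  (fun N => (visits f A N x)%:R / N%:R : R) @ \oo --> a <->
  freq_ge A a /\ freq_le A a.
Proof.
split=> [/cvgrPdist_le cva|[ge_a le_a]].
  split=> e e0; near=> N; have N0 : 0 < N%:R :> R.
  1,3: by rewrite ltr0n; near: N; exact: nbhs_infty_gt.
    rewrite -ler_pdivlMr//.
    have : `|a - (visits f A N x)%:R / N%:R| <= e by near: N; exact: cva.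
    by rewrite ler_norml; lra.
  rewrite -ler_pdivrMr//.
  have : `|a - (visits f A N x)%:R / N%:R| <= e by near: N; exact: cva.
  by rewrite ler_norml; lra.
apply/cvgrPdist_le => e e0; near=> N; have N0 : 0 < N%:R :> R.
  by rewrite ltr0n; near: N; exact: nbhs_infty_gt.
have : (a - e) * N%:R <= (visits f A N x)%:R by near: N; exact: ge_a.
have : (visits f A N x)%:R <= (a + e) * N%:R by near: N; exact: le_a.
rewrite -ler_pdivrMr// => ?; rewrite -ler_pdivlMr// => ?.
by rewrite ler_norml; lra.
Unshelve. all: by end_near. Qed.

Lemma freq_geS A B a : A `<=` B -> freq_ge A a -> freq_ge B a.
Proof.
move=> AB Aa e e0; apply: filterS (Aa e e0) => N /le_trans; apply.
by rewrite ler_nat sub_visits.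
Qed.

Lemma freq_geU A B a b : [disjoint A & B] ->
  freq_ge A a -> freq_ge B b -> freq_ge (A `|` B) (a + b).
Proof.
move=> AB Aa Bb e e0; have e20 : 0 < e / 2 by rewrite divr_gt0.
apply: filterS2 (Aa _ e20) (Bb _ e20) => N; rewrite visits_setU// natrD.
lra.
Qed.

Lemma freq_ge0 A : freq_ge A 0.
Proof.
move=> e e0; apply: nearW => N; rewrite sub0r mulNr.
by rewrite (@le_trans _ _ 0)// oppr_le0 mulr_ge0// ltW.
Qed.

Lemma freq_ge_cvg A (u : R^nat) a : u @ \oo --> a ->
  (forall i, freq_ge A (u i)) -> freq_ge A a.
Proof.
move=> /cvgrPdist_le ua Au e e0; have e20 : 0 < e / 2 by rewrite divr_gt0.
have [i _ /(_ i (leqnn i))] := ua _ e20; rewrite /= ler_norml => /andP[_ aui].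
apply: filterS (Au i _ e20) => N /(le_trans _); apply.
by rewrite ler_wpM2r//; lra.
Qed.

Lemma freq_ge_setC A a : freq_ge (~` A) (1 - a) <-> freq_le A a.
Proof.
have sumN N : (visits f A N x)%:R + (visits f (~` A) N x)%:R = N%:R :> R.
  by rewrite -natrD visits_setC.
by split=> Aa e e0; apply: filterS (Aa e e0) => N; have := sumN N; lra.
Qed.

End Frequency.

(** * Sets determined by finitely many digits *)

Section Indistinguishable.
Variables (X : Type) (F : digit_map X).
Implicit Types (A : set X) (l j k : nat) (x y : X).

(** The first [l] digits agree.  Comparing cells instead of naming digits makes
    the relation insensitive to a renaming of the digits. *)
Definition indist l x y : Prop := forall i d, (i < l)%N -> digit F d ->
  cell F d (iter i F x) <-> cell F d (iter i F y).

Definition saturated l A : Prop := forall x y, indist l x y -> A x -> A y.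

Lemma indist_sym l x y : indist l x y -> indist l y x.
Proof. by move=> xy i d il Fd; apply: iff_sym; exact: xy. Qed.

Lemma indist_leq l j x y : (l <= j)%N -> indist j x y -> indist l x y.
Proof. by move=> lj xy i d il; apply: xy; exact: leq_trans lj. Qed.

Lemma indist_iter l i x y :
  indist (i + l) x y -> indist l (iter i F x) (iter i F y).
Proof.
by move=> xy j d jl; rewrite -!iterD addnC; apply: xy; rewrite ltn_add2l.
Qed.

Lemma saturatedC l A : saturated l A -> saturated l (~` A).
Proof. by move=> Al x y xy; apply: contra_not; apply/Al/indist_sym. Qed.

Lemma saturated_preimage l i A :
  saturated l A -> saturated (i + l) (iter i F @^-1` A).
Proof. by move=> Al x y /indist_iter; exact: Al. Qed.

(** Visits to [A] before time [M] depend on the first [M + l] digits only. *)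
Lemma saturated_excess (R : realDomainType) l M A (c : R) :
  saturated l A -> saturated (M + l) (excess F A c M).
Proof.
move=> Al x y xy xE j /[dup] /xE + /andP[_ jM].
rewrite (_ : visits F A j x = visits F A j y)//.
apply: eq_bigr => i _; have {}xy : indist (i + l) x y.
  by apply: indist_leq xy; rewrite leq_add2r (leq_trans (ltnW (ltn_ord i))).
congr nat_of_bool; apply/idP/idP => /set_mem h; apply/mem_set; apply: Al h;
  first exact: indist_iter.
exact/indist_sym/indist_iter.
Qed.

Lemma cylinder_indist s x y : digit_string F s -> indist (size s) x y ->
  cylinder F s x -> cylinder F s y.
Proof.
elim: s x y => [//|d s IH] x y Fs xy [dx sx].
split; first by apply/(xy 0%N d) => //; apply: Fs; rewrite mem_head.
apply: IH sx; first by move=> e es; apply: Fs; rewrite inE es orbT.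
by rewrite /= -add1n in xy; exact: (indist_iter xy).
Qed.

Hypothesis disj : trivIset (digit F) (cell F).
Hypothesis cov : cover (digit F) (cell F) = setT.

Lemma exists_cylinder l x :
  exists s, [/\ size s = l, digit_string F s & cylinder F s x].
Proof.
elim: l x => [|l IH] x; first by exists [::].
have [d Fd dx] : cover (digit F) (cell F) x by rewrite cov.
have [s [sl Fs sx]] := IH (F x); exists (d :: s); split=> //=.
  by rewrite sl.
by move=> e; rewrite inE => /orP[/eqP ->//|]; exact: Fs.
Qed.

Lemma indist_cylinder s x y : digit_string F s ->
  cylinder F s x -> cylinder F s y -> indist (size s) x y.
Proof.
elim: s x y => [//|d s IH] x y Fs [dx sx] [dy sy].
have Fd : digit F d by apply: Fs; rewrite mem_head.
have one z e : digit F e -> cell F d z -> cell F e z -> d = e.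
  by move=> Fe dz ez; apply: disj => //; exists z.
move=> [|i] e il Fe /=.
  by split=> [/(one _ _ Fe dx) <-|/(one _ _ Fe dy) <-].
rewrite -!iterS !iterSr; apply: IH => //.
by move=> e' e's; apply: Fs; rewrite inE e's orbT.
Qed.

(** The cylinder of the string coded by [i] if that cylinder has length [l] and
    is contained in [A], and the empty set otherwise; thus the cylinders of
    length [l] inside [A] are enumerated by natural numbers. *)
Definition piece l A i : set X :=
  [set x | let s := CodeSeq.decode i in
    [/\ size s = l, digit_string F s, cylinder F s `<=` A & cylinder F s x]].

Lemma saturated_bigcup l A : saturated l A -> A = \bigcup_i piece l A i.
Proof.
move=> Al; apply/seteqP; split=> [x Ax|x [i _ [_ _ +]]]; last exact.
have [s [sl Fs sx]] := exists_cylinder l x.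
exists (CodeSeq.code s) => //; rewrite /piece/= CodeSeq.codeK; split=> //.
move=> y sy; apply: Al Ax; rewrite -sl; exact: indist_cylinder sx sy.
Qed.

Lemma piece_cylinder l A i : piece l A i = set0 \/
  exists2 s, digit_string F s & piece l A i = cylinder F s.
Proof.
have [[sl Fs sA]|h] := pselect (let s := CodeSeq.decode i in
  [/\ size s = l, digit_string F s & cylinder F s `<=` A]); [right|left].
  by exists (CodeSeq.decode i) => //; apply/seteqP; split=> x; [case|].
by apply/seteqP; split=> // x [? ? ? ?]; apply: h.
Qed.

Lemma piece_disjoint l A i j :
  piece l A i `<=` piece l A j \/ [disjoint piece l A i & piece l A j].
Proof.
have [/eqP ij|] := boolP (piece l A i `&` piece l A j == set0).
  by right; apply/disj_setPS => x; rewrite ij.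
move=> /set0P[x [[il Fi _ ix] [jl Fj jA jx]]]; left=> y [_ _ _ iy]; split=> //.
apply: cylinder_indist jx => //; rewrite jl -il.
exact: indist_cylinder ix iy.
Qed.

End Indistinguishable.

Section Iterate.
Variables (X : Type) (F G : digit_map X).
Hypothesis disjG : trivIset (digit G) (cell G).
Hypothesis covG : cover (digit G) (cell G) = setT.

Lemma iter_iter T (f : T -> T) n i x : iter i (iter n f) x = iter (i * n) f x.
Proof. by elim: i => [//|i IH]; rewrite iterS IH mulSn iterD. Qed.

Lemma indist_iterate n l x y :
  indist F (l * n) x y -> indist (iterate F n) l x y.
Proof.
move=> xy i _ il [s [sn Fs] <-] /=; rewrite CodeSeq.codeK !iter_iter.
have {}xy : indist F (size s) (iter (i * n) F x) (iter (i * n) F y).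
  apply: indist_iter; apply: indist_leq xy.
  by rewrite sn -mulSnr leq_mul2r il orbT.
by split; apply: cylinder_indist => //; exact: indist_sym.
Qed.

(** The position [j < l * k] is the digit number [j %% k] of the digit number
    [j %/ k] with respect to [G^k]. *)
Lemma indist_of_iterate k l x y :
  indist (iterate G k) l x y -> indist G (l * k) x y.
Proof.
move=> xy j d jlk Gd.
have k0 : (0 < k)%N by case: k jlk {xy}; rewrite ?muln0.
have jl : (j %/ k < l)%N by rewrite ltn_divLR.
have [s [sk Gs sx]] := exists_cylinder covG k (iter (j %/ k * k) G x).
have := xy (j %/ k)%N (CodeSeq.code s) jl; rewrite /= CodeSeq.codeK !iter_iter.
move=> /(_ _)[|/(_ sx) sy _]; first by exists s.
have := indist_cylinder disjG Gs sx sy; rewrite sk => /(_ (j %% k)%N d).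
by rewrite -!iterD addnC -divn_eq ltn_pmod//; exact.
Qed.

Lemma indist_same l x y :
  same_digit_map F G -> indist F l x y -> indist G l x y.
Proof.
move=> [FG cFG].
have half z t i d : indist F l z t -> (i < l)%N -> digit G d ->
    cell G d (iter i G z) -> cell G d (iter i G t).
  move=> zt il Gd dz.
  have [[e Fe eE] _] : ([set cell F d | d in digit F] `\ set0) (cell G d).
    rewrite cFG; split; first by exists d.
    by move=> d0; rewrite d0 in dz.
  move: dz; rewrite -eE -!(eq_iter FG); exact: (zt i e il Fe).1.
by move=> xy i d il Gd; split; apply: half => //; exact: indist_sym.
Qed.

End Iterate.

Lemma same_digit_map_sym X (F G : digit_map X) :
  same_digit_map F G -> same_digit_map G F.
Proof. by case=> FG cFG; split=> // x; rewrite FG. Qed.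

(** The first [l * n] digits for [T] determine the first [l] digits for
    [T^n = S^k], hence the first [l * k] digits for [S], and [l <= l * k]. *)
Lemma saturated_same_iterate X (T S : digit_map X) n k l A :
  trivIset (digit S) (cell S) -> cover (digit S) (cell S) = setT ->
  (0 < k)%N -> same_digit_map (iterate T n) (iterate S k) ->
  saturated S l A -> saturated T (l * n) A.
Proof.
move=> disjS covS k0 TS Al x y xy; apply: Al.
apply: (@indist_leq _ _ _ (l * k)); first by rewrite leq_pmulr.
apply: indist_of_iterate => //; apply: indist_same TS _.
exact: indist_iterate.
Qed.

(** * Transfer of normality along a common iterate *)

Section DigitSystem.
Context {d : measure_display} {X : measurableType d} {R : realType}.
Implicit Types (F T S : digit_map X) (mu : probability X R) (A : set X) (x : X).

(** The combinatorial and ergodic core of a number-theoretic transformation,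
    over an arbitrary measurable space. *)
Record digit_system F mu : Prop := {
  ds_disjoint : trivIset (digit F) (cell F);
  ds_cover : cover (digit F) (cell F) = setT;
  ds_cylinder : forall s, digit_string F s -> measurable (cylinder F s);
  ds_measurable : forall A, measurable A -> measurable (F @^-1` A);
  ds_invariant : forall A, measurable A -> mu (F @^-1` A) = mu A;
  ds_ergodic : forall A, measurable A ->
    mu ((F @^-1` A) `+` A) = 0%E -> mu A = 0%E \/ mu A = 1%E
}.

Definition generic F mu x : Prop := forall s, admissible F s ->
  (fun N => (visits F (cylinder F s) N x)%:R / N%:R : R)
    @ \oo --> fine (mu (cylinder F s)).

Lemma measurable_piece F mu l A i : digit_system F mu ->
  measurable (piece F l A i).
Proof.
move=> Fmu; have [->//|[s Fs ->]] := piece_cylinder F l A i.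
exact: ds_cylinder Fmu _ Fs.
Qed.

Lemma measurable_saturated F mu l A : digit_system F mu ->
  saturated F l A -> measurable A.
Proof.
move=> Fmu Al; rewrite (saturated_bigcup (ds_disjoint Fmu) (ds_cover Fmu) Al).
by apply: bigcupT_measurable => i; exact: measurable_piece Fmu.
Qed.

(** A saturated set can be an infinite union of cylinders.  Frequencies are
    finitely additive, so the lower bound passes to finite unions, and then to
    the whole set because these unions exhaust its measure. *)
Lemma generic_freq_ge F mu x l A : digit_system F mu -> generic F mu x ->
  saturated F l A -> freq_ge F x A (fine (mu A)).
Proof.
move=> Fmu xF Al; have mP i := measurable_piece l A i Fmu.
pose P i := piece F l A i; pose D i := \big[setU/set0]_(j < i) P j.
have mD i : measurable (D i) by exact: bigsetU_measurable.
have PF i : freq_ge F x (P i) (fine (mu (P i))).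
  rewrite /P; have [->|[s Fs ->]] := piece_cylinder F l A i.
    by rewrite measure0; exact: freq_ge0.
  have [->|/set0P s0] := eqVneq (cylinder F s) set0.
    by rewrite measure0; exact: freq_ge0.
  by have /cvg_freq[] := xF s (conj Fs s0).
have DF i : freq_ge F x (D i) (fine (mu (D i))).
  elim: i => [|i IH]; first by rewrite /D big_ord0 measure0; exact: freq_ge0.
  have -> : D i.+1 = D i `|` P i by rewrite /D big_ord_recr.
  have [PD|DP] : P i `<=` D i \/ [disjoint D i & P i].
    have [[j Pij]|/forallNP h] := pselect (exists j : 'I_i, P i `<=` P j).
      by left=> y /Pij Py; rewrite /D -bigcup_mkord; exists j => /=.
    right; apply/disj_setPS => y [+ Py].
    rewrite /D -bigcup_mkord => -[j ji Pjy].
    have [//|/disj_setPS/(_ y)] := piece_disjoint (ds_disjoint Fmu) l A i j.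
      by move=> /(h (Ordinal ji)).
    by apply; split.
  - by rewrite setUidl.
  - rewrite measureU//; last exact/disj_set2P.
    rewrite fineD ?fin_num_measure//; exact: freq_geU.
have AE : A = \bigcup_i D i.
  rewrite [LHS](saturated_bigcup (ds_disjoint Fmu) (ds_cover Fmu) Al).
  apply/seteqP; split=> [y [i _ Py]|y [i _]].
    by exists i.+1 => //; rewrite /D big_ord_recr; right.
  by rewrite /D -bigcup_mkord => -[j _ Py]; exists j.
have mA := measurable_saturated Fmu Al.
apply: (@freq_ge_cvg _ _ _ _ _ (fun i => fine (mu (D i)))) => [|i].
  apply: fine_cvg; rewrite fineK ?fin_num_measure// [in mu A]AE.
  apply: nondecreasing_cvg_mu; rewrite -?AE// => i j ij.
  exact/subsetPset/subset_bigsetU.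
by apply: freq_geS (DF i); rewrite [X in _ `<=` X]AE; exact: bigcup_sup.
Qed.

(** The lower bound for the complement, which is saturated as well. *)
Lemma generic_freq_le F mu x l A : digit_system F mu -> generic F mu x ->
  saturated F l A -> freq_le F x A (fine (mu A)).
Proof.
move=> Fmu xF Al; have mA := measurable_saturated Fmu Al.
apply/freq_ge_setC; have := generic_freq_ge Fmu xF (saturatedC Al).
by rewrite probability_setC// fineB ?fin_num_measure.
Qed.

(** The main estimate: [muS] controls the visits of the [S]-orbit of a point
    that is only known to be generic for [T]. *)
Lemma generic_iterate_freq_le T S muT muS n k x l A :
  digit_system T muT -> digit_system S muS ->
  (forall B, measurable B -> muS B = 0%E -> muT B = 0%E) ->
  (0 < n)%N -> (0 < k)%N -> same_digit_map (iterate T n) (iterate S k) ->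
  generic T muT x -> saturated S l A -> freq_le S x A (fine (muS A)).
Proof.
move=> TT SS muST n0 k0 TS xT Al e e0.
have mA := measurable_saturated SS Al.
(* Of the slack [e], one half goes into [c]; a frequency [q] of visits
   to the preimages of [E M] under [T] amounts to a quarter of [e] under [S]. *)
set a := fine _; pose c := a + e / 2; pose q := e / (4 * n%:R).
have nR : 0 < n%:R :> R by rewrite ltr0n.
have a0 : 0 <= a by exact: fine_ge0.
have c0 : 0 <= c by rewrite addr_ge0// divr_ge0// ltW.
have q0 : 0 < q by rewrite divr_gt0// mulr_gt0.
have q20 : 0 < q / 2 by rewrite divr_gt0.
pose E M : set X := excess S A c M.
have mE M : measurable (E M) := measurable_excess (ds_measurable SS) c M mA.
have mEr r M : measurable (iter r S @^-1` E M).
  exact: measurable_iter (ds_measurable SS) _ _ (mE M).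
have E0 : muS (\bigcap_M E M) = 0%E.
  have [_ _ _ mS invS ergS] := SS.
  apply: (ergodic_excess0 mS invS ergS) => //.
  rewrite -[ltLHS](fineK (fin_num_measure muS A mA)) lte_fin -/a /c.
  by rewrite ltrDl divr_gt0.
have mcap : measurable (\bigcap_M E M) by exact: bigcapT_measurable.
have Er r : fine (muT (iter r S @^-1` E M)) @[M --> \oo] --> (0 : R).
  apply: fine_cvg.
  have <- : muT (\bigcap_M (iter r S @^-1` E M)) = (0 : R)%:E.
    rewrite -preimage_bigcap; apply: muST.
      exact: measurable_iter (ds_measurable SS) _ _ mcap.
    exact: etrans (measure_iter (ds_measurable SS) (ds_invariant SS) r mcap) E0.
  apply: nonincreasing_cvg_mu => //.
  - by rewrite ltey_eq fin_num_measure.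
  - exact: bigcapT_measurable.
  - move=> M M' MM'; apply/subsetPset => y.
    by have /subsetPset := excess_nonincreasing S A c MM'; exact.
have [M EM] : exists M, forall r : 'I_k,
    fine (muT (iter r S @^-1` E M)) <= q / 2.
  suff [M _ /(_ M (leqnn M)) ?] : \forall M \near \oo,
      forall r : 'I_k, fine (muT (iter r S @^-1` E M)) <= q / 2 by exists M.
  apply: filter_forall => r; exact: cvgr_le (Er r) _ q20.
have [N0 _ HN0] : \forall N \near \oo, forall r : 'I_k,
    (visits T (iter r S @^-1` E M) N x)%:R <= q * N%:R.
  apply: filter_forall => r.
  have satE : saturated S (r + (M + l)) (iter r S @^-1` E M).
    exact: saturated_preimage (saturated_excess Al).
  have := generic_freq_le TT xT
    (saturated_same_iterate (ds_disjoint SS) (ds_cover SS) k0 TS satE).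
  move=> /(_ _ q20); apply: filterS => N /le_trans; apply.
  by rewrite ler_wpM2r//; have := EM r; lra.
near=> N.
(* [k * N'] is the first multiple of [k] beyond [N]. *)
pose N' := (N %/ k).+1.
have NkN' : (N <= k * N' <= N + k)%N.
  by have := divn_eq N k; have := ltn_pmod N k0; rewrite /N'; nia.
have E_N : (visits S (E M) N x)%:R <= e / 4 * (N%:R + k%:R).
  apply: (@le_trans _ _ (\sum_(r < k) q * (n * N')%:R)).
    apply: (@le_trans _ _ (visits S (E M) (k * N') x)%:R).
      by rewrite ler_nat leq_visits//; case/andP: NkN'.
    rewrite visits_iterate natr_sum; apply: ler_sum => r _.
    apply: (@le_trans _ _ (visits T (iter r S @^-1` E M) (n * N') x)%:R).
      rewrite ler_nat (leq_trans _ (visits_iter_leq T _ _ _ n0))//.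
      rewrite /visits; apply: eq_leq; apply: eq_bigr => i _.
      by rewrite (eq_iter TS.1).
    apply: HN0 => /=.
    have kN : (N0 * k <= N)%N by near: N; exact: nbhs_infty_ge.
    have := leq_divRL N0 N k0; rewrite kN => NkN0.
    by rewrite (leq_trans NkN0)// (leq_trans (leqnSn _))// leq_pmull.
  rewrite sumr_const card_ord.
  have -> : q * (n * N')%:R *+ k = e / 4 * (k * N')%:R.
    rewrite -[LHS]mulr_natr.
    by rewrite !natrM /q; field; rewrite lt0r_neq0.
  by rewrite ler_pM2l ?divr_gt0// -natrD ler_nat; case/andP: NkN'.
have := visits_block S A M N x c0.
have : c * M%:R + e / 4 * k%:R <= e / 4 * N%:R.
  rewrite [leRHS]mulrC -ler_pdivrMr ?divr_gt0//.
  near: N; exact: nbhs_infty_ger.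
rewrite -/(E M) natrD mulrDr /c; move: E_N; lra.
Unshelve. all: by end_near. Qed.

Lemma generic_iterate T S muT muS n k x :
  digit_system T muT -> digit_system S muS ->
  (forall B, measurable B -> muS B = 0%E -> muT B = 0%E) ->
  (0 < n)%N -> (0 < k)%N -> same_digit_map (iterate T n) (iterate S k) ->
  generic T muT x -> generic S muS x.
Proof.
move=> TT SS muST n0 k0 TS xT s [Ss _].
have sat : saturated S (size s) (cylinder S s).
  by move=> y z; exact: cylinder_indist.
have le B : saturated S (size s) B -> freq_le S x B (fine (muS B)).
  exact: generic_iterate_freq_le TT SS muST n0 k0 TS xT.
apply/cvg_freq; split; last exact: le.
have mA := ds_cylinder SS Ss.
have /freq_ge_setC := le _ (saturatedC sat).
by rewrite setCK probability_setC// fineB ?fin_num_measure// subKr.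
Qed.

End DigitSystem.

Lemma number_theoretic_system (R : realType) (m : nat) (Omega : set 'rV[R]_m)
    (w : Omega) (Sigma : set (set Omega)) (F : digit_map Omega)
    (mu : probability (sigma_space w Sigma) R) :
  sigma_algebra setT Sigma -> number_theoretic F mu ->
  digit_system (X := sigma_space w Sigma) F mu.
Proof.
move=> sig Fmu.
have mE := @measurable_g_measurableTypeE (pointed_at w) Sigma sig.
split.
- exact: nt_disjoint Fmu.
- exact: nt_cover Fmu.
- by move=> s /(nt_cylinder Fmu); rewrite mE.
- by move=> A; rewrite mE; exact: nt_measurable Fmu A.
- by move=> A; rewrite mE; exact: nt_invariant Fmu A.
- by move=> A; rewrite mE; exact: nt_ergodic Fmu A.
Qed.

Lemma normal_generic (R : realType) (m : nat) (Omega : set 'rV[R]_m)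
    (w : Omega) (Sigma : set (set Omega)) (F : digit_map Omega)
    (mu : probability (sigma_space w Sigma) R) (x : Omega) :
  normal F mu x <-> generic (X := sigma_space w Sigma) F mu x.
Proof.
have freqE s :
    (fun N => #|[pred i : 'I_N | iter i F x \in cylinder F s]|%:R / N%:R : R) =
    (fun N => (visits F (cylinder F s) N x)%:R / N%:R).
  apply/funext => N; congr (_%:R / _); rewrite -sum1_card big_mkcond.
  by apply: eq_bigr => i _; rewrite inE; case: ifP.
by split=> xF s /xF; rewrite freqE.
Qed.

Theorem theorem1p2 (R : realType) (m : nat) (Omega : set 'rV[R]_m)
  (bounded_Omega : bounded_set Omega) (w : Omega)
  (Sigma : set (set Omega)) (Sigma_sigma_algebra : sigma_algebra setT Sigma)
  (T S : digit_map Omega) (muT muS : probability (sigma_space w Sigma) R)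
  (T_nt : number_theoretic T muT) (S_nt : number_theoretic S muS)
  (n k : nat) (n_gt0 : (0 < n)%N) (k_gt0 : (0 < k)%N)
  (TnSk : same_digit_map (iterate T n) (iterate S k)) :
  forall x : Omega, normal T muT x <-> normal S muS x.
Proof.
move=> x; have mE :=
  @measurable_g_measurableTypeE (pointed_at w) Sigma Sigma_sigma_algebra.
have TT := number_theoretic_system Sigma_sigma_algebra T_nt.
have SS := number_theoretic_system Sigma_sigma_algebra S_nt.
have null (B : set Omega) : Sigma B -> muT B = 0%E <-> muS B = 0%E.
  move=> SB; have [_ eqT] := nt_equivalent T_nt SB.
  have [_ eqS] := nt_equivalent S_nt SB.
  exact: iff_trans eqT (iff_sym eqS).
split=> /normal_generic xN; apply/normal_generic.
  apply: (generic_iterate TT SS _ n_gt0 k_gt0 TnSk xN) => B.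
  by rewrite mE => /null[].
apply: (generic_iterate SS TT _ k_gt0 n_gt0 (same_digit_map_sym TnSk) xN) => B.
by rewrite mE => /null[].
Qed.
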